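(* For $s\in\mathbb{C}$ with $\Re(s)>1$ we have $$\sum_{k=1}^{\infty}\left\{\frac{\zeta_k^2(s)}{k^s}-\frac{\zeta_k(s)}{k^{2s}}\right\}=\frac{\zeta^3(s)-\zeta(3s)}{3},$$ and this identity is also true for other values of $s$ by meromorphic continuation, except $s=1$ and $s=\frac{1}{3}$.
   Context: For a positive integer $m$ and $s\in\mathbb{C}$, $\zeta_m(s)=\sum_{j=1}^m j^{-s}$. $\zeta(s)$ is the Riemann zeta function, defined by $\zeta(s)=\sum_{j=1}^{\infty}j^{-s}$ for $\Re(s)>1$ and admitting a meromorphic continuation to the whole complex plane. Powers mean $\zeta_m^r(s)=(\zeta_m(s))^r$ and $\zeta^r(s)=(\zeta(s))^r$. *)

(* Defs.v *)
From Stdlib Require Import Reals.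
From Coquelicot Require Import Coquelicot.

Open Scope C_scope.

Definition Cexp (z : C) : C :=
  ((exp (Re z) * cos (Im z))%R, (exp (Re z) * sin (Im z))%R).

(* n ^ s = exp (s ln n), meaningful for n >= 1 only (Stdlib's [ln 0] is 0). *)
Definition npow (n : nat) (s : C) : C := Cexp (s * RtoC (ln (INR n))).

Definition zeta_partial (m : nat) (s : C) : C :=
  sum_n_m (fun j : nat => npow j (- s)) 1 m.

Definition analytic_at (f : C -> C) (z0 : C) : Prop :=
  exists (a : nat -> C) (r : R), (0 < r)%R /\
    forall z : C, (Cmod (z - z0) < r)%R -> is_pseries a (z - z0) (f z).

(* A Laurent expansion with finite principal part, on a punctured disc: the
   value [f z0] is irrelevant, and a removable singularity is allowed. *)
Definition meromorphic_at (f : C -> C) (z0 : C) : Prop :=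
  exists (N : nat) (a : nat -> C) (r : R), (0 < r)%R /\
    forall z : C, z <> z0 -> (Cmod (z - z0) < r)%R ->
      is_pseries a (z - z0) ((z - z0) ^ N * f z).

(* [F] is meromorphic on the whole plane, its poles all lie in [P], and for
   Re s > 1 the series a s 1 + a s 2 + a s 3 + ... converges with sum [F s].
   A meromorphic function is encoded as a total function; its values on [P]
   are unconstrained. *)
Definition meromorphic_continuation
    (a : C -> nat -> C) (P : C -> Prop) (F : C -> C) : Prop :=
  (forall s : C, (1 < Re s)%R -> is_series (fun k : nat => a s (S k)) (F s)) /\
  (forall s : C, meromorphic_at F s) /\
  (forall s : C, ~ P s -> analytic_at F s).

(* This determines [zeta] on the complement of 1, by the identity theorem. *)
Definition is_riemann_zeta (zeta : C -> C) : Prop :=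
  meromorphic_continuation (fun s j => npow j (- s)) (fun s => s = RtoC 1) zeta.

Definition summand (s : C) (k : nat) : C :=
  zeta_partial k s ^ 2 / npow k s - zeta_partial k s / npow k (2 * s).

(* Main.v *)
Require Import Defs.
From Stdlib Require Import Reals Arith Classical Lra Lia.
From Coquelicot Require Import Coquelicot.

Open Scope C_scope.

(** Telescoping [zeta_k^3 - zeta_(k-1)^3] evaluates the partial sums in closed
    form, which gives the identity for [Re s > 1]. The right-hand side is a
    polynomial in [zeta s] and [zeta (3 s)], hence meromorphic with possible
    poles only at [1] and [1/3]. For uniqueness, the difference [H] of two
    continuations vanishes for [Re s > 1] and is analytic off two points of the
    real axis: zeros propagate along horizontal segments to every [s] with
    [Im s <> 0], and then to the remaining real points because these are
    limits of zeros. *)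

(** * Complex limits and series through real and imaginary parts *)

Lemma Re_sum_n (a : nat -> C) (n : nat) :
  Re (sum_n a n) = sum_n (fun k => Re (a k)) n.
Proof.
induction n as [|n IH]; [now rewrite !sum_O|].
now rewrite !sum_Sn, <- IH.
Qed.

Lemma Im_sum_n (a : nat -> C) (n : nat) :
  Im (sum_n a n) = sum_n (fun k => Im (a k)) n.
Proof.
induction n as [|n IH]; [now rewrite !sum_O|].
now rewrite !sum_Sn, <- IH.
Qed.

(** The uniform structure on [C] is that of the product of two real lines: its balls are squares and
    both projections are continuous. This carries real limit theorems over to [C]. *)
Lemma filterlim_C_iff (u : nat -> C) (l : C) :
  filterlim u eventually (@locally C_UniformSpace l) <->
  is_lim_seq (fun n => Re (u n)) (Re l) /\ is_lim_seq (fun n => Im (u n)) (Im l).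
Proof.
split.
- intros H; destruct l as [l1 l2]; split; unfold is_lim_seq; simpl.
  + exact (filterlim_comp _ _ _ u fst _ _ _ H
      (continuous_fst (U := R_UniformSpace) (V := R_UniformSpace) l1 l2)).
  + exact (filterlim_comp _ _ _ u snd _ _ _ H
      (continuous_snd (U := R_UniformSpace) (V := R_UniformSpace) l1 l2)).
- intros [H1 H2]. apply filterlim_locally; intros eps.
  generalize (proj1 (filterlim_locally _ _) H1 eps)
    (proj1 (filterlim_locally _ _) H2 eps); intros A B.
  generalize (filter_and _ _ A B). apply filter_imp; intros n [P Q].
  split; assumption.
Qed.

Lemma is_series_C_iff (a : nat -> C) (l : C) :
  @is_series C_AbsRing C_NormedModule a l <->
  is_series (fun n => Re (a n)) (Re l) /\ is_series (fun n => Im (a n)) (Im l).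
Proof.
unfold is_series at 1. rewrite (filterlim_C_iff (sum_n a) l).
unfold is_lim_seq; simpl.
split; intros [H1 H2]; split;
  (eapply filterlim_ext; [|eassumption]); intros n; cbv beta;
  first [apply Re_sum_n | apply Im_sum_n | symmetry; apply Re_sum_n | symmetry; apply Im_sum_n].
Qed.

Lemma ex_series_Rabs_Re (a : nat -> C) :
  ex_series (fun n => Cmod (a n)) -> ex_series (fun n => Rabs (Re (a n))).
Proof.
apply (ex_series_le (K := R_AbsRing) (V := R_CompleteNormedModule)).
intros n. change (norm (Rabs (Re (a n)))) with (Rabs (Rabs (Re (a n)))).
rewrite Rabs_Rabsolu. apply re_le_Cmod.
Qed.

Lemma ex_series_Rabs_Im (a : nat -> C) :
  ex_series (fun n => Cmod (a n)) -> ex_series (fun n => Rabs (Im (a n))).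
Proof.
apply (ex_series_le (K := R_AbsRing) (V := R_CompleteNormedModule)).
intros n. change (norm (Rabs (Im (a n)))) with (Rabs (Rabs (Im (a n)))).
rewrite Rabs_Rabsolu.
eapply Rle_trans; [|apply Rmax_Cmod]. apply Rmax_r.
Qed.

(** Four real Cauchy products, recombined as in (x + iy)(x' + iy'). Absolute convergence passes from
    the moduli to the real and imaginary parts. *)
Lemma is_series_C_mult (a b : nat -> C) (la lb : C) :
  @is_series C_AbsRing C_NormedModule a la ->
  @is_series C_AbsRing C_NormedModule b lb ->
  ex_series (fun n => Cmod (a n)) -> ex_series (fun n => Cmod (b n)) ->
  @is_series C_AbsRing C_NormedModule
    (fun n => sum_n (fun k => a k * b (n - k)%nat) n) (la * lb).
Proof.
intros Ha Hb Aa Ab.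
apply is_series_C_iff in Ha as [Ha1 Ha2]; apply is_series_C_iff in Hb as [Hb1 Hb2].
generalize (ex_series_Rabs_Re _ Aa) (ex_series_Rabs_Im _ Aa)
  (ex_series_Rabs_Re _ Ab) (ex_series_Rabs_Im _ Ab); intros A1 A2 B1 B2.
apply is_series_C_iff; split.
- eapply is_series_ext;
    [|exact (is_series_minus _ _ _ _ (is_series_mult _ _ _ _ Ha1 Hb1 A1 B1)
             (is_series_mult _ _ _ _ Ha2 Hb2 A2 B2))].
  intros n; cbv beta. rewrite Re_sum_n, sum_n_Reals. symmetry.
  exact (minus_sum _ _ n).
- eapply is_series_ext;
    [|exact (is_series_plus _ _ _ _ (is_series_mult _ _ _ _ Ha1 Hb2 A1 B2)
             (is_series_mult _ _ _ _ Ha2 Hb1 A2 B1))].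
  intros n; cbv beta. rewrite Im_sum_n, sum_n_Reals. symmetry.
  exact (plus_sum _ _ n).
Qed.

(** * Complex power series: bounds on terms and absolute convergence *)

Lemma is_pseries_C_iff (a : nat -> C) (w l : C) :
  @is_pseries C_AbsRing C_NormedModule a w l <->
  @is_series C_AbsRing C_NormedModule (fun k => w ^ k * a k) l.
Proof.
assert (E : forall k, @scal _ C_NormedModule (pow_n (K := C_AbsRing) w k) (a k) = w ^ k * a k)
  by reflexivity.
split; apply is_series_ext; intros k; [|symmetry]; apply E.
Qed.

Lemma Cmod_le_Re_Im (z : C) : (Cmod z <= Rabs (Re z) + Rabs (Im z))%R.
Proof.
destruct z as [x y]; simpl.
replace (x, y) with ((x, 0%R) + (0%R, y))
  by (unfold Cplus; simpl; now rewrite Rplus_0_r, Rplus_0_l).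
eapply Rle_trans; [apply Cmod_triangle|].
apply Req_le; unfold Cmod; simpl.
rewrite <- !sqrt_Rsqr_abs; unfold Rsqr.
f_equal; f_equal; ring.
Qed.

Lemma series_C_partial_sums (a : nat -> C) (l : C) :
  @is_series C_AbsRing C_NormedModule a l ->
  forall eps : R, (0 < eps)%R ->
  exists N, forall n, (N <= n)%nat -> (Cmod (sum_n a n - l) < eps)%R.
Proof.
intros H eps He.
apply (proj1 (filterlim_C_iff (sum_n a) l)) in H as [H1 H2].
apply is_lim_seq_spec in H1; apply is_lim_seq_spec in H2.
assert (He2 : (0 < eps / 2)%R) by lra.
destruct (H1 (mkposreal _ He2)) as [N1 K1]; destruct (H2 (mkposreal _ He2)) as [N2 K2].
simpl in K1, K2. exists (max N1 N2); intros n Hn.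
eapply Rle_lt_trans; [apply Cmod_le_Re_Im|].
generalize (K1 n ltac:(lia)) (K2 n ltac:(lia)). unfold Re, Im; simpl. unfold Rminus. lra.
Qed.

(** The real and imaginary parts of the terms tend to 0, and convergent sequences are bounded. *)
Lemma series_C_terms_bounded (a : nat -> C) (l : C) :
  @is_series C_AbsRing C_NormedModule a l ->
  exists B, forall n, (Cmod (a n) <= B)%R.
Proof.
intros H. apply is_series_C_iff in H as [H1 H2].
generalize (ex_series_lim_0 _ (ex_intro _ _ H1)) (ex_series_lim_0 _ (ex_intro _ _ H2)).
intros L1 L2.
destruct (filterlim_bounded (K := R_AbsRing) (V := R_NormedModule) _
  (ex_intro (fun x : R_NormedModule => filterlim _ eventually (locally x)) 0%R L1)) as [B1 K1].
destruct (filterlim_bounded (K := R_AbsRing) (V := R_NormedModule) _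
  (ex_intro (fun x : R_NormedModule => filterlim _ eventually (locally x)) 0%R L2)) as [B2 K2].
exists (B1 + B2)%R; intros n.
eapply Rle_trans; [apply Cmod_le_Re_Im|].
apply Rplus_le_compat; [apply K1|apply K2].
Qed.

(** Convergence at the single real point [rho] bounds the terms there, whose moduli are
    [Cmod (a n) * rho ^ n]. *)
Lemma pseries_C_coef_bound (a : nat -> C) (r rho : R) :
  (0 <= rho < r)%R ->
  (forall w, (Cmod w < r)%R -> exists l, @is_pseries C_AbsRing C_NormedModule a w l) ->
  exists B, forall n, (Cmod (a n) * rho ^ n <= B)%R.
Proof.
intros [H0 H1] H.
assert (E : Cmod (RtoC rho) = rho) by (rewrite Cmod_R; apply Rabs_pos_eq, H0).
destruct (H (RtoC rho)) as [l Hl]; [now rewrite E|].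
apply is_pseries_C_iff, series_C_terms_bounded in Hl as [B HB].
exists B; intros n. generalize (HB n). rewrite Cmod_mult, Cmod_pow, E. lra.
Qed.

Lemma pseries_C_abs_conv (a : nat -> C) (r : R) (w : C) :
  (Cmod w < r)%R ->
  (forall w, (Cmod w < r)%R -> exists l, @is_pseries C_AbsRing C_NormedModule a w l) ->
  ex_series (fun k => Cmod (w ^ k * a k)).
Proof.
intros Hw H. pose proof (Cmod_ge_0 w) as W0.
(* The midpoint leaves room on both sides: the coefficient bound holds at [rho < r], and the
   comparison series has ratio [Cmod w / rho < 1]. *)
set (rho := ((Cmod w + r) / 2)%R).
assert (Hrho : (0 <= rho < r)%R) by (unfold rho; lra).
assert (Hrho2 : (Cmod w < rho)%R) by (unfold rho; lra).
destruct (pseries_C_coef_bound a r rho Hrho H) as [B HB].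
apply (ex_series_le (K := R_AbsRing) (V := R_CompleteNormedModule)) with
  (b := fun k => scal B ((Cmod w / rho) ^ k)%R).
- intros n. change (norm (Cmod (w ^ n * a n))) with (Rabs (Cmod (w ^ n * a n))).
  rewrite Rabs_pos_eq by apply Cmod_ge_0.
  rewrite Cmod_mult, Cmod_pow. change (scal B ((Cmod w / rho) ^ n)%R) with (B * (Cmod w / rho) ^ n)%R.
  replace (Cmod w ^ n)%R with ((Cmod w / rho) ^ n * rho ^ n)%R
    by (rewrite <- Rpow_mult_distr; f_equal; field; lra).
  rewrite Rmult_assoc, (Rmult_comm (rho ^ n)), (Rmult_comm B).
  apply Rmult_le_compat_l; [|apply HB].
  apply pow_le, Rdiv_le_0_compat; lra.
- apply (ex_series_scal (K := R_AbsRing) (V := R_NormedModule) B).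
  eexists; apply is_series_geom.
  rewrite Rabs_pos_eq by (apply Rdiv_le_0_compat; lra).
  apply Rmult_lt_reg_r with rho; [lra|]. unfold Rdiv.
  rewrite Rmult_assoc, Rinv_l; lra.
Qed.

(** * Closure properties of analytic functions *)

Lemma analytic_at_ext (f g : C -> C) (z0 : C) (r : R) :
  (0 < r)%R -> (forall z, (Cmod (z - z0) < r)%R -> f z = g z) ->
  analytic_at f z0 -> analytic_at g z0.
Proof.
intros Hr E [a [r' [Hr' H]]].
exists a, (Rmin r r'); split; [now apply Rmin_glb_lt|].
intros z Hz. rewrite <- E by (eapply Rlt_le_trans; [apply Hz|apply Rmin_l]).
apply H. eapply Rlt_le_trans; [apply Hz|apply Rmin_r].
Qed.

Lemma analytic_at_const (c z0 : C) : analytic_at (fun _ => c) z0.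
Proof.
exists (fun n => match n with O => c | S _ => 0 end), 1%R; split; [lra|].
intros z _. apply is_pseries_C_iff. unfold is_series.
apply filterlim_ext with (fun _ : nat => c); [|apply filterlim_const].
intros n; induction n as [|n IH].
- rewrite sum_O. simpl. ring.
- rewrite sum_Sn, <- IH. change (c = c + (z - z0) ^ S n * 0). ring.
Qed.

Lemma analytic_at_plus (f g : C -> C) (z0 : C) :
  analytic_at f z0 -> analytic_at g z0 -> analytic_at (fun z => f z + g z) z0.
Proof.
intros [a [r [Hr H]]] [b [r' [Hr' H']]].
exists (PS_plus a b), (Rmin r r'); split; [now apply Rmin_glb_lt|].
intros z Hz. apply (is_pseries_plus a b).
- apply H. eapply Rlt_le_trans; [apply Hz|apply Rmin_l].
- apply H'. eapply Rlt_le_trans; [apply Hz|apply Rmin_r].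
Qed.

(** The coefficients are those of the Cauchy product; convergence on a whole disc supplies the
    absolute convergence that the product of series requires. *)
Lemma analytic_at_mult (f g : C -> C) (z0 : C) :
  analytic_at f z0 -> analytic_at g z0 -> analytic_at (fun z => f z * g z) z0.
Proof.
intros [a [r [Hr H]]] [b [r' [Hr' H']]].
exists (fun n => sum_n (fun k => a k * b (n - k)%nat) n), (Rmin r r').
split; [now apply Rmin_glb_lt|].
assert (conv : forall (h : C -> C) c s, 
  (forall z, (Cmod (z - z0) < s)%R -> @is_pseries C_AbsRing C_NormedModule c (z - z0) (h z)) ->
  forall w, (Cmod w < s)%R -> exists l, @is_pseries C_AbsRing C_NormedModule c w l).
{ intros h c s Hh w Hw. exists (h (w + z0)).
  generalize (Hh (w + z0)). replace (w + z0 - z0) with w by ring. auto. }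
intros z Hz.
assert (Hz1 : (Cmod (z - z0) < r)%R) by (eapply Rlt_le_trans; [apply Hz|apply Rmin_l]).
assert (Hz2 : (Cmod (z - z0) < r')%R) by (eapply Rlt_le_trans; [apply Hz|apply Rmin_r]).
apply is_pseries_C_iff.
eapply is_series_ext; [|apply is_series_C_mult].
2: apply is_pseries_C_iff, H, Hz1.
2: apply is_pseries_C_iff, H', Hz2.
2: apply (pseries_C_abs_conv a r _ Hz1), (conv f a r H).
2: apply (pseries_C_abs_conv b r' _ Hz2), (conv g b r' H').
intros n; cbv beta.
rewrite <- (sum_n_mult_l (K := C_Ring)).
apply sum_n_ext_loc. intros k Hk.
change ((z - z0) ^ k * a k * ((z - z0) ^ (n - k)%nat * b (n - k)%nat)
  = (z - z0) ^ n * (a k * b (n - k)%nat)).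
replace ((z - z0) ^ n) with ((z - z0) ^ k * (z - z0) ^ (n - k)%nat)
  by (rewrite <- Cpow_add_r; f_equal; lia).
ring.
Qed.

Lemma analytic_at_id (z0 : C) : analytic_at (fun z => z) z0.
Proof.
(* The factor 1 is kept so that the first summand is the constant series 1 shifted by one degree. *)
apply analytic_at_ext with (fun z => (z - z0) * 1 + z0) 1%R; [lra|intros; ring|].
apply (analytic_at_plus (fun z => (z - z0) * 1)); [|apply analytic_at_const].
destruct (analytic_at_const 1 z0) as [a [r [Hr H]]].
exists (PS_incr_1 a), r; split; [exact Hr|]. intros z Hz.
apply (is_pseries_incr_1 a), H, Hz.
Qed.

Lemma analytic_at_pow (f : C -> C) (n : nat) (z0 : C) :
  analytic_at f z0 -> analytic_at (fun z => f z ^ n) z0.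
Proof.
intros H; induction n as [|n IH]; [apply (analytic_at_const 1)|].
apply (analytic_at_mult f _ _ H IH).
Qed.

Lemma analytic_at_scale (f : C -> C) (c z0 : C) :
  c <> 0 -> analytic_at f (c * z0) -> analytic_at (fun z => f (c * z)) z0.
Proof.
intros Hc [a [r [Hr H]]].
assert (C0 := proj1 (Cmod_gt_0 c) Hc).
exists (fun k => c ^ k * a k), (r / Cmod c)%R; split; [now apply Rdiv_lt_0_compat|].
intros z Hz. apply is_pseries_C_iff.
assert (Hz' : (Cmod (c * z - c * z0) < r)%R).
{ replace (c * z - c * z0) with (c * (z - z0)) by ring.
  rewrite Cmod_mult, Rmult_comm. now apply Rlt_div_r. }
generalize (proj1 (is_pseries_C_iff _ _ _) (H _ Hz')).
apply is_series_ext; intros k.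
change ((c * z - c * z0) ^ k * a k = (z - z0) ^ k * (c ^ k * a k)).
replace (c * z - c * z0) with (c * (z - z0)) by ring.
rewrite Cpow_mult_l; ring.
Qed.

(** * Closure properties of meromorphic functions *)

(** Clearing the pole gives an honest analytic function, so closure properties reduce to the
    analytic ones. *)
Lemma meromorphic_at_iff (f : C -> C) (z0 : C) :
  meromorphic_at f z0 <->
  exists (N : nat) (g : C -> C) (r : R), analytic_at g z0 /\ (0 < r)%R /\
    forall z, z <> z0 -> (Cmod (z - z0) < r)%R -> (z - z0) ^ N * f z = g z.
Proof.
split.
- intros [N [a [r [Hr H]]]].
  (* The centre is filled in with [a 0], the sum of the power series there. *)
  set (g := fun z => if Ceq_dec z z0 then a 0%nat else (z - z0) ^ N * f z).
  exists N, g, r; repeat split; [|exact Hr|].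
  + exists a, r; split; [exact Hr|]. intros z Hz. unfold g.
    destruct (Ceq_dec z z0) as [->|Hn]; [|now apply H].
    replace (z0 - z0) with (RtoC 0) by ring. apply (is_pseries_0 a).
  + intros z Hn _. unfold g. now destruct (Ceq_dec z z0).
- intros [N [g [r [[a [r' [Hr' H]]] [Hr E]]]]].
  exists N, a, (Rmin r r'); split; [now apply Rmin_glb_lt|].
  intros z Hn Hz. rewrite E; [|exact Hn|].
  + apply H. eapply Rlt_le_trans; [apply Hz|apply Rmin_r].
  + eapply Rlt_le_trans; [apply Hz|apply Rmin_l].
Qed.

Lemma analytic_meromorphic (f : C -> C) (z0 : C) :
  analytic_at f z0 -> meromorphic_at f z0.
Proof.
intros H. apply meromorphic_at_iff. exists 0%nat, f, 1%R.
repeat split; [exact H|lra|]. intros; simpl; ring.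
Qed.

Lemma meromorphic_at_mult (f g : C -> C) (z0 : C) :
  meromorphic_at f z0 -> meromorphic_at g z0 -> meromorphic_at (fun z => f z * g z) z0.
Proof.
rewrite !meromorphic_at_iff.
intros [N [f' [r [Hf [Hr Ef]]]]] [M [g' [r' [Hg [Hr' Eg]]]]].
exists (N + M)%nat, (fun z => f' z * g' z), (Rmin r r').
repeat split; [now apply analytic_at_mult|now apply Rmin_glb_lt|].
intros z Hn Hz.
rewrite <- Ef, <- Eg, Cpow_add_r; try exact Hn; [ring| |];
  (eapply Rlt_le_trans; [apply Hz|]); [apply Rmin_r|apply Rmin_l].
Qed.

Lemma meromorphic_at_plus (f g : C -> C) (z0 : C) :
  meromorphic_at f z0 -> meromorphic_at g z0 -> meromorphic_at (fun z => f z + g z) z0.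
Proof.
rewrite !meromorphic_at_iff.
intros [N [f' [r [Hf [Hr Ef]]]]] [M [g' [r' [Hg [Hr' Eg]]]]].
assert (P : forall n, analytic_at (fun z => (z - z0) ^ n) z0).
{ intros n. apply analytic_at_pow.
  apply (analytic_at_plus (fun z => z)); [apply analytic_at_id|apply analytic_at_const]. }
(* Common denominator [(z - z0) ^ (N + M)]: each numerator is multiplied by the denominator of the
   other. *)
exists (N + M)%nat, (fun z => (z - z0) ^ M * f' z + (z - z0) ^ N * g' z), (Rmin r r').
repeat split; [|now apply Rmin_glb_lt|].
- apply analytic_at_plus; apply analytic_at_mult; auto.
- intros z Hn Hz.
  rewrite <- Ef, <- Eg, Cpow_add_r; try exact Hn; [ring| |];
    (eapply Rlt_le_trans; [apply Hz|]); [apply Rmin_r|apply Rmin_l].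
Qed.

Lemma meromorphic_at_scale (f : C -> C) (c z0 : C) :
  c <> 0 -> meromorphic_at f (c * z0) -> meromorphic_at (fun z => f (c * z)) z0.
Proof.
rewrite !meromorphic_at_iff.
intros Hc [N [g [r [Hg [Hr E]]]]].
assert (C0 := proj1 (Cmod_gt_0 c) Hc).
(* The constant compensates for (cz - cz0)^N = c^N (z - z0)^N. *)
exists N, (fun z => / c ^ N * g (c * z)), (r / Cmod c)%R.
repeat split; [|now apply Rdiv_lt_0_compat|].
- apply analytic_at_mult; [apply analytic_at_const|now apply analytic_at_scale].
- intros z Hn Hz.
  assert (Hd : c * z - c * z0 = c * (z - z0)) by ring.
  rewrite <- E.
  + rewrite Hd, Cpow_mult_l. field. now apply Cpow_nz.
  + intros Eq. apply Hn. rewrite <- (Cmult_1_l z), <- (Cmult_1_l z0), <- (Cinv_l c Hc).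
    now rewrite <- !Cmult_assoc, Eq.
  + rewrite Hd, Cmod_mult, Rmult_comm. now apply Rlt_div_r.
Qed.

(** * Isolated zeros and the identity theorem *)

Definition locally_zero (H : C -> C) (z0 : C) : Prop :=
  exists r : R, (0 < r)%R /\ forall z, (Cmod (z - z0) < r)%R -> H z = 0.

Definition zeros_cluster (H : C -> C) (z0 : C) : Prop :=
  forall eps : R, (0 < eps)%R ->
  exists z, z <> z0 /\ (Cmod (z - z0) < eps)%R /\ H z = 0.

(* The tail after the first possibly nonzero term [w^n a_n] is dominated by a
   geometric series of ratio [q = |w|/rho <= 1/2]. *)
Lemma pseries_C_first_term_le (a : nat -> C) (n : nat) (rho B : R) (w : C) :
  (0 < rho)%R -> (2 * Cmod w <= rho)%R ->
  (forall k, (Cmod (a k) * rho ^ k <= B)%R) ->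
  (forall k, (k < n)%nat -> a k = 0) ->
  @is_pseries C_AbsRing C_NormedModule a w (RtoC 0) ->
  (Cmod (w ^ n * a n) <= 2 * B * (Cmod w / rho) ^ S n)%R.
Proof.
intros Hrho Hw HB Ha Hs.
set (q := (Cmod w / rho)%R).
assert (W0 := Cmod_ge_0 w).
assert (Q0 : (0 <= q)%R) by (apply Rdiv_le_0_compat; lra).
assert (Q1 : (2 * q <= 1)%R).
{ apply Rmult_le_reg_r with rho; [lra|]. unfold q.
  replace (2 * (Cmod w / rho) * rho)%R with (2 * Cmod w)%R by (field; lra). lra. }
assert (B0 : (0 <= B)%R).
{ eapply Rle_trans; [|apply (HB 0%nat)]. simpl. rewrite Rmult_1_r. apply Cmod_ge_0. }
assert (T : forall k, (Cmod (w ^ k * a k) <= B * q ^ k)%R).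
{ intros k. rewrite Cmod_mult, Cmod_pow.
  replace (Cmod w ^ k)%R with (q ^ k * rho ^ k)%R
    by (rewrite <- Rpow_mult_distr; f_equal; unfold q; field; lra).
  rewrite Rmult_assoc, (Rmult_comm (rho ^ k)), (Rmult_comm B).
  apply Rmult_le_compat_l; [now apply pow_le|apply HB]. }
set (ps := sum_n (G := C_AbelianMonoid) (fun k => w ^ k * a k) : nat -> C).
assert (ps_lt : forall m, (m < n)%nat -> ps m = 0).
{ intros m; induction m as [|m IH]; intros Hm; unfold ps.
  - rewrite sum_O, (Ha _ Hm). ring.
  - rewrite sum_Sn. change (ps m + w ^ S m * a (S m) = 0).
    rewrite (IH ltac:(lia)), (Ha _ Hm). ring. }
assert (ps_n : ps n = w ^ n * a n).
{ destruct n as [|n]; unfold ps; [apply sum_O|].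
  rewrite sum_Sn. change (ps n + w ^ S n * a (S n) = w ^ S n * a (S n)).
  rewrite (ps_lt n ltac:(lia)). ring. }
(* The subtracted term makes the induction close: [2 * q <= 1] gives q^m <= 2 q^m - 2 q^(m+1), which
   absorbs the next term. *)
assert (D : forall d, (Cmod (ps (n + d)%nat - w ^ n * a n)
    <= B * (2 * q ^ S n - 2 * q ^ S (n + d)))%R).
{ intros d; induction d as [|d IH].
  - rewrite Nat.add_0_r, ps_n. replace (w ^ n * a n - w ^ n * a n) with (RtoC 0) by ring.
    rewrite Cmod_0. lra.
  - rewrite Nat.add_succ_r.
    replace (ps (S (n + d))) with
      (ps (n + d)%nat + w ^ S (n + d) * a (S (n + d)))
      by (symmetry; apply (sum_Sn (G := C_AbelianMonoid))).
    set (t := w ^ S (n + d) * a (S (n + d))).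
    replace (ps (n + d)%nat + t - w ^ n * a n)
      with ((ps (n + d)%nat - w ^ n * a n) + t) by ring.
    eapply Rle_trans; [apply Cmod_triangle|].
    assert (Ht : (Cmod t <= B * q ^ S (n + d))%R) by apply T.
    assert (P : (0 <= B * q ^ S (n + d))%R)
      by (apply Rmult_le_pos; [lra|now apply pow_le]).
    replace (q ^ S (S (n + d)))%R
      with (q * q ^ S (n + d))%R by reflexivity.
    nra. }
apply Rnot_lt_le; intros Hlt.
(* The partial sums tend to 0, so some late one is smaller than [gap]; yet by [D] they all stay
   within [2 * B * q ^ S n] of the first term. *)
set (gap := (Cmod (w ^ n * a n) - 2 * B * q ^ S n)%R).
assert (G : (0 < gap)%R) by (unfold gap; lra).
apply is_pseries_C_iff in Hs.
destruct (series_C_partial_sums _ _ Hs gap G) as [N HN].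
generalize (HN (n + N)%nat ltac:(lia)) (D N).
change (sum_n _ (n + N)%nat) with (ps (n + N)%nat).
replace (ps (n + N)%nat - 0) with (ps (n + N)%nat) by ring.
intros K1 K2.
assert (K3 : (Cmod (w ^ n * a n) <= Cmod (ps (n + N)%nat) + Cmod (ps (n + N)%nat - w ^ n * a n))%R).
{ rewrite <- (Cmod_opp (ps (n + N)%nat - _)).
  replace (w ^ n * a n) with (ps (n + N)%nat + - (ps (n + N)%nat - w ^ n * a n)) at 1 by ring.
  apply Cmod_triangle. }
assert (P : (0 <= B * q ^ S (n + N))%R)
  by (apply Rmult_le_pos; [lra|now apply pow_le]).
unfold gap in K1. lra.
Qed.

(** All coefficients vanish, by strong induction: if the earlier ones do, a zero at distance d gives
    |a_n| d^n <= 2B (d/rho)^(n+1), that is |a_n| rho^(n+1) <= 2Bd, and d can be taken arbitrarily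
    small. *)
Lemma analytic_zeros_cluster (H : C -> C) (z0 : C) :
  analytic_at H z0 -> zeros_cluster H z0 -> locally_zero H z0.
Proof.
intros [a [r [Hr Ha]]] Hz.
assert (conv : forall w, (Cmod w < r)%R -> exists l, @is_pseries C_AbsRing C_NormedModule a w l).
{ intros w Hw. exists (H (w + z0)).
  generalize (Ha (w + z0)). replace (w + z0 - z0) with w by ring. auto. }
set (rho := (r / 2)%R).
destruct (pseries_C_coef_bound a r rho ltac:(unfold rho; lra) conv) as [B HB].
assert (R0 : (0 < rho)%R) by (unfold rho; lra).
assert (A0 : forall n, a n = 0).
{ intros n; induction n as [n IH] using lt_wf_ind.
  apply Cmod_eq_0. apply Rle_antisym; [|apply Cmod_ge_0].
  apply Rnot_lt_le; intros Hlt.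
  assert (P : (0 < rho ^ S n)%R) by now apply pow_lt.
  assert (B0 : (0 <= B)%R).
  { eapply Rle_trans; [|apply (HB 0%nat)]. simpl. rewrite Rmult_1_r. apply Cmod_ge_0. }
  (* The first bound makes the ratio d/rho at most 1/2; the second contradicts |a_n| rho^(n+1) <=
     2Bd. The [+ 1] keeps the denominator positive when [B] is 0. *)
  set (eps := Rmin (rho / 2) (Cmod (a n) * rho ^ S n / (2 * B + 1))%R).
  assert (E : (0 < eps)%R).
  { apply Rmin_glb_lt; [lra|]. apply Rdiv_lt_0_compat; [|lra].
    now apply Rmult_lt_0_compat. }
  destruct (Hz eps E) as [z [Hn [Hd H0]]].
  assert (L1 : (Cmod (z - z0) < rho / 2)%R) by (eapply Rlt_le_trans; [apply Hd|apply Rmin_l]).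
  assert (L2 : (Cmod (z - z0) < Cmod (a n) * rho ^ S n / (2 * B + 1))%R)
    by (eapply Rlt_le_trans; [apply Hd|apply Rmin_r]).
  assert (Hw : z - z0 <> 0).
  { intros Eq. apply Hn. replace z with (z - z0 + z0) by ring. rewrite Eq; ring. }
  apply Cmod_gt_0 in Hw.
  assert (K := pseries_C_first_term_le a n rho B (z - z0) R0 ltac:(lra) HB IH).
  (* The sum 0 is rewritten as [H z], so that the expansion of [H] at [z] is the required
     premise. *)
  rewrite <- H0 in K. specialize (K (Ha z ltac:(unfold rho in *; lra))).
  rewrite Cmod_mult, Cmod_pow in K.
  set (d := Cmod (z - z0)) in *.
  assert (K' : (Cmod (a n) * rho ^ S n <= 2 * B * d)%R).
  { apply Rmult_le_reg_l with (d ^ n)%R; [now apply pow_lt|].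
    unfold Rdiv in K. rewrite Rpow_mult_distr, pow_inv in K.
    apply Rmult_le_compat_r with (r := (rho ^ S n)%R) in K; [|lra].
    replace (2 * B * (d ^ S n * / rho ^ S n) * rho ^ S n)%R
      with (2 * B * d ^ S n)%R in K by (field; lra).
    replace (d ^ S n)%R with (d * d ^ n)%R in K by reflexivity. lra. }
  apply Rlt_div_r in L2; [|lra]. nra. }
exists r; split; [exact Hr|]. intros z Hd.
assert (K := proj1 (is_pseries_C_iff _ _ _) (Ha z Hd)).
apply (filterlim_C_iff (sum_n _)) in K as [K1 K2].
assert (Z : forall n, sum_n (G := C_AbelianMonoid) (fun k => (z - z0) ^ k * a k) n = RtoC 0).
{ intros n; induction n as [|n IH].
  - rewrite sum_O, A0. apply Cmult_0_r.
  - rewrite sum_Sn, IH, A0. change (0 + (z - z0) ^ S n * 0 = 0). ring. }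
apply injective_projections.
- apply is_lim_seq_unique in K1.
  rewrite (Lim_seq_ext _ (fun _ => 0%R)), Lim_seq_const in K1.
  + now injection K1.
  + intros n. exact (f_equal Re (Z n)).
- apply is_lim_seq_unique in K2.
  rewrite (Lim_seq_ext _ (fun _ => 0%R)), Lim_seq_const in K2.
  + now injection K2.
  + intros n. exact (f_equal Im (Z n)).
Qed.

(** Connectedness of the segment: the supremum of the times up to which [H] vanishes near the path
    is attained, because zeros accumulate there, and it cannot precede 1, because vanishing near a
    point is an open condition. *)
Lemma locally_zero_segment (H : C -> C) (z v : C) :
  v <> 0 ->
  (forall t : R, (0 <= t <= 1)%R -> analytic_at H (z + RtoC t * v)) ->
  locally_zero H z -> locally_zero H (z + v).
Proof.
intros Hv An H0.
set (g := fun t : R => z + RtoC t * v).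
assert (V0 := proj1 (Cmod_gt_0 v) Hv).
assert (gd : forall s t, Cmod (g s - g t) = (Rabs (s - t) * Cmod v)%R).
{ intros s t. replace (g s - g t) with (RtoC (s - t) * v)
    by (unfold g; rewrite RtoC_minus; ring).
  now rewrite Cmod_mult, Cmod_R. }
(* Quantifying over all earlier [u] makes [E] closed downwards in [0, 1], so every time below its
   supremum [T] is good. *)
set (E := fun t => (0 <= t <= 1)%R /\ forall u, (0 <= u <= t)%R -> locally_zero H (g u)).
assert (g0 : g 0%R = z) by (unfold g; ring).
assert (E0 : E 0%R).
{ split; [lra|]. intros u Hu. replace u with 0%R by lra. now rewrite g0. }
destruct (completeness E) as [T [HT1 HT2]].
{ exists 1%R. intros t [Ht _]; lra. }
{ now exists 0%R. }
assert (T0 : (0 <= T)%R) by now apply HT1.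
assert (T1 : (T <= 1)%R) by (apply HT2; intros t [Ht _]; lra).
assert (below : forall u, (0 <= u < T)%R -> locally_zero H (g u)).
{ intros u Hu.
  assert (exists t, E t /\ (u < t)%R) as [t [[Ht Et] Hut]].
  { apply NNPP; intros K.
    apply (Rlt_not_le T u); [apply Hu|]. apply HT2. intros t Ht.
    apply Rnot_lt_le; intros Hlt. apply K. now exists t. }
  apply Et; lra. }
assert (atT : locally_zero H (g T)).
{ destruct (Req_dec T 0) as [->|HT]; [now rewrite g0|].
  apply analytic_zeros_cluster; [apply An; lra|].
  intros eps He.
  assert (De : (0 < eps / Cmod v)%R) by now apply Rdiv_lt_0_compat.
  (* [T / 2] keeps [T - d] in [0, T), and the other bound puts [g (T - d)] within [eps] of [g T]. It
     differs from [g T] since [v] is nonzero. *)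
  set (d := Rmin (T / 2) (eps / Cmod v / 2)).
  assert (D0 : (0 < d)%R) by (apply Rmin_glb_lt; lra).
  assert (D1 : (d <= T / 2)%R) by apply Rmin_l.
  assert (D2 : (d <= eps / Cmod v / 2)%R) by apply Rmin_r.
  assert (dist : Cmod (g (T - d)%R - g T) = (d * Cmod v)%R).
  { rewrite gd. f_equal. replace (T - d - T)%R with (- d)%R by ring.
    rewrite Rabs_Ropp. apply Rabs_pos_eq; lra. }
  exists (g (T - d)%R); repeat split.
  - intros K. rewrite K in dist. replace (g T - g T) with (RtoC 0) in dist by ring.
    rewrite Cmod_0 in dist. nra.
  - rewrite dist. apply Rlt_div_r; lra.
  - destruct (below (T - d)%R ltac:(lra)) as [r [Hr Z]].
    apply Z. replace (g (T - d)%R - g (T - d)%R) with (RtoC 0) by ring.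
    now rewrite Cmod_0. }
assert (TT : T = 1%R).
{ apply Rle_antisym; [exact T1|]. apply Rnot_lt_le; intros HT.
  destruct atT as [r [Hr Z]].
  (* A step that stays in [0, 1] and inside the disc of zeros about [g T]; then [T + d] belongs to
     [E], against the choice of [T]. *)
  set (d := Rmin (1 - T) (r / Cmod v / 2)).
  assert (De : (0 < r / Cmod v)%R) by now apply Rdiv_lt_0_compat.
  assert (D0 : (0 < d)%R) by (apply Rmin_glb_lt; lra).
  assert (D1 : (d <= 1 - T)%R) by apply Rmin_l.
  assert (D2 : (d <= r / Cmod v / 2)%R) by apply Rmin_r.
  assert (T + d <= T)%R; [|lra].
  apply HT1. split; [lra|]. intros u Hu.
  destruct (Rlt_le_dec u T) as [Hlt|Hge]; [apply below; lra|].
  assert (Hu' : (Cmod (g u - g T) < r)%R).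
  { rewrite gd, Rabs_pos_eq by lra. apply Rlt_div_r; lra. }
  (* This smaller disc about [g u] lies inside the disc of zeros about [g T]. *)
  exists (r - Cmod (g u - g T))%R; split; [lra|].
  intros y Hy. apply Z.
  replace (y - g T) with ((y - g u) + (g u - g T)) by ring.
  eapply Rle_lt_trans; [apply Cmod_triangle|]. lra. }
replace (z + v) with (g T) by (rewrite TT; unfold g; ring). exact atT.
Qed.

(** With [P] on the real axis, a horizontal line at nonzero height never meets it, so straight
    segments suffice and no path around the poles is needed. *)
Lemma analytic_identity_off_real_axis (P : C -> Prop) (H : C -> C) :
  (forall s, P s -> Im s = 0%R) ->
  (forall s, ~ P s -> analytic_at H s) ->
  (forall s, (1 < Re s)%R -> H s = 0) ->
  forall s, ~ P s -> H s = 0.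
Proof.
intros HP An Z.
assert (value : forall s, locally_zero H s -> H s = 0).
{ intros s [r [Hr K]]. apply K.
  replace (s - s) with (RtoC 0) by ring. now rewrite Cmod_0. }
assert (off : forall s, Im s <> 0%R -> H s = 0).
{ intros s Hs. apply value.
  (* Strictly to the right of [s], so the segment is nondegenerate, and at least 2, so the unit disc
     about [(x, Im s)] lies in Re > 1. *)
  set (x := (Rabs (Re s) + 2)%R).
  assert (Hx : (Re s < x)%R) by (unfold x; generalize (Rle_abs (Re s)); lra).
  assert (Hx2 : (2 <= x)%R) by (unfold x; generalize (Rabs_pos (Re s)); lra).
  replace s with ((x, Im s) + (s - (x, Im s))) by ring.
  apply locally_zero_segment.
  - intros K. apply (f_equal Re) in K. simpl in K. unfold Re in Hx. lra.
  - intros t _. apply An. intros K. apply Hs. apply HP in K.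
    simpl in K. unfold Im. rewrite <- K. unfold Im; ring.
  - exists 1%R; split; [lra|]. intros w Hw. apply Z.
    assert (K := Rle_trans _ _ _ (Rle_abs _) (re_le_Cmod ((x, Im s) - w))).
    rewrite <- Cmod_opp in K.
    replace (- ((x, Im s) - w)) with (w - (x, Im s)) in K by ring.
    simpl in K. unfold Re. lra. }
intros s Hs. destruct (Req_dec (Im s) 0) as [Hi|Hi]; [|now apply off].
apply value, analytic_zeros_cluster; [now apply An|].
(* A vertical shift of a real point leaves the real axis, where [off] provides a zero. *)
intros eps He. exists (s + (0%R, (eps / 2)%R)); repeat split.
- intros K. apply (f_equal Im) in K. simpl in K. unfold Im in Hi, K. lra.
- set (i := (0%R, (eps / 2)%R) : C). replace (s + i - s) with i by ring. unfold i.
  eapply Rle_lt_trans; [apply Cmod_le_Re_Im|]. simpl.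
  rewrite Rabs_R0, Rabs_pos_eq; lra.
- apply off. simpl. unfold Im in Hi. lra.
Qed.

(** * Complex powers and the telescoping sum *)

Lemma Cexp_plus (x y : C) : Cexp (x + y) = Cexp x * Cexp y.
Proof.
unfold Cexp. destruct x as [a b], y as [c d]; simpl.
rewrite exp_plus, cos_plus, sin_plus. unfold Cmult; simpl. f_equal; ring.
Qed.

Lemma Cexp_0 : Cexp 0 = 1.
Proof. unfold Cexp; simpl. rewrite exp_0, cos_0, sin_0. now rewrite Rmult_1_l, Rmult_0_r. Qed.

Lemma npow_plus (n : nat) (s t : C) : npow n (s + t) = npow n s * npow n t.
Proof. unfold npow. rewrite <- Cexp_plus. f_equal. ring. Qed.

(** Only the exponential law enters, so [n = 0] is no exception. *)
Lemma npow_opp (n : nat) (s : C) : npow n (- s) = / npow n s.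
Proof.
assert (E : npow n s * npow n (- s) = 1).
{ rewrite <- npow_plus. unfold npow. rewrite <- Cexp_0. f_equal. ring. }
assert (N : npow n s <> 0).
{ intros K. rewrite K, Cmult_0_l in E. now apply C1_nz. }
rewrite <- (Cmult_1_l (npow n (- s))), <- (Cinv_l _ N), <- Cmult_assoc, E. ring.
Qed.

Lemma zeta_partial_0 (s : C) : zeta_partial 0 s = 0.
Proof. apply (sum_n_m_zero (G := C_AbelianMonoid)); lia. Qed.

Lemma zeta_partial_S (m : nat) (s : C) :
  zeta_partial (S m) s = zeta_partial m s + npow (S m) (- s).
Proof. apply (sum_n_Sm (G := C_AbelianMonoid)); lia. Qed.

Lemma sum_n_zeta_partial (s : C) (n : nat) :
  sum_n (G := C_AbelianMonoid) (fun j => npow (S j) (- s)) n = zeta_partial (S n) s.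
Proof.
induction n as [|n IH].
- rewrite sum_O, zeta_partial_S, zeta_partial_0. symmetry; apply Cplus_0_l.
- now rewrite sum_Sn, IH, (zeta_partial_S (S n)).
Qed.

(* With b = k^(-s), the term a^2 b - a b^2 (a = zeta_k) equals
   (a^3 - (a - b)^3 - b^3) / 3, and a - b = zeta_(k-1). *)
Lemma summand_telescopes (s : C) (k : nat) :
  summand s (S k) =
  (zeta_partial (S k) s ^ 3 - zeta_partial (S k) (3 * s)) / 3
  - (zeta_partial k s ^ 3 - zeta_partial k (3 * s)) / 3.
Proof.
assert (E3 : npow (S k) (- (3 * s)) = npow (S k) (- s) ^ 3).
{ replace (- (3 * s)) with (- s + (- s + - s)) by ring.
  rewrite !npow_plus. ring. }
assert (E2 : / npow (S k) (2 * s) = npow (S k) (- s) ^ 2).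
{ rewrite <- npow_opp. replace (- (2 * s)) with (- s + - s) by ring.
  rewrite npow_plus. ring. }
(* Only the two quotients of the summand are unfolded; the divisions by 3 stay for [field]. *)
unfold summand, Cdiv at 1 2. rewrite E2, <- npow_opp, !zeta_partial_S, E3.
field.
Qed.

Lemma sum_n_summand (s : C) (n : nat) :
  sum_n (G := C_AbelianMonoid) (fun k => summand s (S k)) n =
  (zeta_partial (S n) s ^ 3 - zeta_partial (S n) (3 * s)) / 3.
Proof.
induction n as [|n IH].
- rewrite sum_O, summand_telescopes, !zeta_partial_0.
  (* The equality is retyped from the monoid carrier to [C], where [field] applies. *)
  match goal with |- ?x = ?y => change (x = y :> C) end. field.
- rewrite sum_Sn, IH, summand_telescopes.
  change (((zeta_partial (S n) s ^ 3 - zeta_partial (S n) (3 * s)) / 3)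
   + ((zeta_partial (S (S n)) s ^ 3 - zeta_partial (S (S n)) (3 * s)) / 3
  - (zeta_partial (S n) s ^ 3 - zeta_partial (S n) (3 * s)) / 3)
  = (zeta_partial (S (S n)) s ^ 3 - zeta_partial (S (S n)) (3 * s)) / 3).
  ring.
Qed.

(** * The sum of the series for Re s > 1 *)

Lemma filterlim_C_mult (u v : nat -> C) (l m : C) :
  filterlim u eventually (@locally C_UniformSpace l) ->
  filterlim v eventually (@locally C_UniformSpace m) ->
  filterlim (fun n => u n * v n) eventually (@locally C_UniformSpace (l * m)).
Proof.
rewrite !filterlim_C_iff. intros [A B] [A' B']; split; simpl.
- apply is_lim_seq_minus'; now apply is_lim_seq_mult'.
- apply is_lim_seq_plus'; now apply is_lim_seq_mult'.
Qed.

Lemma filterlim_C_minus (u v : nat -> C) (l m : C) :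
  filterlim u eventually (@locally C_UniformSpace l) ->
  filterlim v eventually (@locally C_UniformSpace m) ->
  filterlim (fun n => u n - v n) eventually (@locally C_UniformSpace (l - m)).
Proof.
rewrite !filterlim_C_iff. intros [A B] [A' B']; split; simpl;
  now apply is_lim_seq_minus'.
Qed.

Lemma is_series_summand (zeta : C -> C) (s : C) :
  is_riemann_zeta zeta -> (1 < Re s)%R ->
  @is_series C_AbsRing C_NormedModule (fun k => summand s (S k))
    ((zeta s ^ 3 - zeta (3 * s)) / 3).
Proof.
intros [Hz _] Hs.
assert (lim : forall t, (1 < Re t)%R ->
  filterlim (fun n => zeta_partial (S n) t) eventually (@locally C_UniformSpace (zeta t))).
{ intros t Ht. generalize (Hz t Ht). apply filterlim_ext. intros n.
  apply sum_n_zeta_partial. }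
unfold is_series.
apply filterlim_ext with
  (fun n => (zeta_partial (S n) s ^ 3 - zeta_partial (S n) (3 * s)) / 3).
{ intros n. symmetry. apply sum_n_summand. }
assert (H3 : (1 < Re (3 * s))%R) by (simpl; unfold Re in Hs; lra).
apply (filterlim_C_mult _ (fun _ => / 3)); [|apply filterlim_const].
apply filterlim_C_minus; [|now apply lim].
(* The cube unfolds to three factors followed by the constant 1, which the last tactic treats. *)
repeat (apply filterlim_C_mult; [now apply lim|]). apply filterlim_const.
Qed.

(** * Analyticity and meromorphy of the right-hand side, and the theorem *)

Lemma RtoC_3_neq_0 : RtoC 3 <> 0.
Proof. intros K. apply (f_equal Re) in K. simpl in K. lra. Qed.

Lemma zeta_rhs_analytic (zeta : C -> C) (s : C) :
  is_riemann_zeta zeta -> s <> RtoC 1 -> s <> RtoC (1 / 3) ->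
  analytic_at (fun s => (zeta s ^ 3 - zeta (3 * s)) / 3) s.
Proof.
intros [_ [_ Hz]] H1 H3.
assert (A : analytic_at (fun s => zeta (3 * s)) s).
(* The excluded point 1/3 enters here: it is where [3 * s] meets the possible pole 1 of [zeta]. *)
{ apply analytic_at_scale; [exact RtoC_3_neq_0|]. apply Hz. intros K. apply H3.
  replace s with (/ 3 * (3 * s)) by (field; exact RtoC_3_neq_0).
  rewrite K, Cmult_1_r, <- RtoC_inv; [f_equal; lra|lra]. }
apply analytic_at_ext with (fun s => / 3 * zeta s ^ 3 + (- / 3) * zeta (3 * s)) 1%R;
  [lra|intros z _; unfold Cdiv; ring|].
apply analytic_at_plus; apply analytic_at_mult; try apply analytic_at_const; [|exact A].
apply analytic_at_pow. now apply Hz.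
Qed.

Lemma zeta_rhs_meromorphic (zeta : C -> C) (s : C) :
  is_riemann_zeta zeta ->
  meromorphic_at (fun s => (zeta s ^ 3 - zeta (3 * s)) / 3) s.
Proof.
intros [_ [Hm _]].
assert (K : forall c, meromorphic_at (fun _ => c) s)
  by (intros c; apply analytic_meromorphic, analytic_at_const).
apply (meromorphic_at_mult (fun s => zeta s ^ 3 - zeta (3 * s))); [|apply K].
apply (meromorphic_at_plus (fun s => zeta s ^ 3) (fun s => - zeta (3 * s))).
- apply (meromorphic_at_mult zeta); [apply Hm|].
  apply (meromorphic_at_mult zeta); [apply Hm|].
  apply (meromorphic_at_mult zeta); [apply Hm|apply (K 1)].
- assert (M := meromorphic_at_mult _ _ s (K (- (1)))
    (meromorphic_at_scale zeta 3 s RtoC_3_neq_0 (Hm _))).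
  (* The Laurent data for the product with -1 serve for the opposite as well, since the two
     functions agree pointwise. *)
  destruct M as [N [a [r [Hr M]]]]. exists N, a, r; split; [exact Hr|].
  intros z Hn Hd. replace (- zeta (3 * z)) with (- (1) * zeta (3 * z)) by ring.
  now apply M.
Qed.

Theorem mainTheorem3 :
  forall zeta : C -> C, is_riemann_zeta zeta ->
  (forall s : C, (1 < Re s)%R ->
     is_series (fun k : nat => summand s (S k))
       ((zeta s ^ 3 - zeta (3 * s)) / 3)) /\
  (exists F : C -> C,
     meromorphic_continuation summand
       (fun s => s = RtoC 1 \/ s = RtoC (1 / 3)) F) /\
  (forall F : C -> C,
     meromorphic_continuation summand
       (fun s => s = RtoC 1 \/ s = RtoC (1 / 3)) F ->
     forall s : C, s <> RtoC 1 -> s <> RtoC (1 / 3) ->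
       F s = (zeta s ^ 3 - zeta (3 * s)) / 3).
Proof.
intros zeta Hz.
assert (series := fun s => is_series_summand zeta s Hz).
assert (analytic : forall s, ~ (s = RtoC 1 \/ s = RtoC (1 / 3)) ->
  analytic_at (fun s => (zeta s ^ 3 - zeta (3 * s)) / 3) s)
  by (intros s Hs; apply zeta_rhs_analytic; tauto).
split; [exact series|]; split.
- exists (fun s => (zeta s ^ 3 - zeta (3 * s)) / 3).
  split; [exact series|]; split; [|exact analytic].
  intros s; now apply zeta_rhs_meromorphic.
- intros F [HF [_ AF]] s H1 H3.
  set (G := fun s => (zeta s ^ 3 - zeta (3 * s)) / 3).
  (* The difference is written with a sum and a product to fit the closure lemmas for analytic
     functions. *)
  assert (D : F s + - (1) * G s = 0).
  { apply (analytic_identity_off_real_axis (fun s => s = RtoC 1 \/ s = RtoC (1 / 3))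
      (fun s => F s + - (1) * G s)).
    - now intros t [->| ->].
    - intros t Ht. apply analytic_at_plus; [now apply AF|].
      apply analytic_at_mult; [apply analytic_at_const|now apply analytic].
    - intros t Ht.
      replace (F t) with (G t); [ring|].
      (* For Re t > 1 both values are limits of the same partial sums. *)
      exact (filterlim_locally_unique (K := C_AbsRing) (V := C_NormedModule) _ _ _
        (series t Ht) (HF t Ht)).
    - tauto. }
  replace (F s) with (F s + - (1) * G s + G s) by ring. rewrite D. apply Cplus_0_l.
Qed.
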